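(* Let $(M,L)$ and $(M,\tilde L)$ be conformal Finsler manifolds with $\tilde g=e^{2\sigma(x)}g$. A necessary and sufficient condition for a geodesic $c$ in $(M,L)$ (resp. in $(M,\tilde L)$) to be a geodesic in $(M,\tilde L)$ (resp. in $(M,L)$) is that $B(\overline\vartheta,\overline\vartheta)=0$, where $\overline\vartheta:=\overline\eta|_{\hat c(t)}$.
   Context: $M$ is a smooth manifold of finite dimension $n$; $\mathcal T M\subset TM$ is the bundle of nonzero tangent vectors, $\pi:\mathcal TM\to M$; $\pi^{-1}(TM)\to\mathcal TM$ is the pullback of $TM$ by $\pi$; its smooth sections are the $\pi$-vector fields. $\overline\eta(u)=(u,u)$. $\gamma:\pi^{-1}(TM)\to T(\mathcal TM)$ is the vertical lift, $\rho:T(\mathcal TM)\to\pi^{-1}(TM)$ is $\rho=(\pi_{\mathcal TM},d\pi)$; $\mathcal C:=\gamma\circ\overline\eta$. For a linear connection $\nabla$ in $\pi^{-1}(TM)$ the deflection map is $K(X)=\nabla_X\overline\eta$; $\nabla$ is regular if $T(\mathcal TM)=\ker\rho\oplus\ker K$; then $\beta:=(\rho|_{\ker K})^{-1}$. Torsion: $\mathbf T(X,Y)=\nabla_X\rho Y-\nabla_Y\rho X-\rho[X,Y]$, $Q(\overline X,\overline Y)=\mathbf T(\beta\overline X,\beta\overline Y)$, $T(\overline X,\overline Y)=\mathbf T(\gamma\overline X,\beta\overline Y)$. A Finsler manifold $(M,L)$: $L:TM\to\mathbb R$, $L\ge0$, $L(0)=0$, $L$ is $C^\infty$ on $\mathcal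 TM$, $C^1$ on $TM$, $\mathcal C\cdot L=L$, and $g$ with components $g_{ij}=\frac12\dot\partial_i\dot\partial_jL^2$ ($\dot\partial_i=\partial/\partial y^i$) is positive definite; $g$ is a metric in $\pi^{-1}(TM)$. The Cartan connection of $(M,L)$ is the unique regular connection with $\nabla g=0$, $Q=0$, $g(T(\overline X,\overline Y),\overline Z)=g(T(\overline X,\overline Z),\overline Y)$. $\sigma$ is a smooth function on $M$. $\nabla$, $\tilde\nabla$ are the Cartan connections of $(M,L)$, $(M,\tilde L)$; $\omega(X,\overline Y):=\tilde\nabla_X\overline Y-\nabla_X\overline Y$, $B(\overline X,\overline Y):=\omega(\beta\overline X,\overline Y)$ with $\beta$ that of $\nabla$. For a regular curve $c:I\to M$, its canonical lift is the curve $\hat c:t\mapsto dc/dt$ in $\mathcal TM$; the velocity field lifts to the $\pi$-vector field $\overline dc/dt:=(dc/dt,dc/dt)=\overline\eta|_{\hat c(t)}$ along $\hat c$. The covariant derivative operator along $\hat c$ is $\frac{D}{dt}\overline X=\nabla_{d\hat c/dt}\overline X$ (resp. $\tilde\nabla_{d\hat c/dt}\overline X$ for $\tilde\nabla$). $c$ is a geodesic in $(M,L)$ if $\frac D{dt}\big(\frac{\overline dc}{dt}\big)=0$ identically; similarly for $(M,\tilde L)$ with $\tilde\nabla$.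
   Formalization: The definition of a Finsler manifold asks L to be C^1 on all of TM, which with homogeneity, L≥0 and positive definite g is impossible in dimension at least 1; here L^2 is required to be C^1 on TM instead, which is implied by the original condition and holds for all usual Finsler structures. *)

(* Defs.v *)
From HB Require Import structures.
From mathcomp Require Import all_boot all_order all_algebra.
From mathcomp Require Import all_classical all_reals all_analysis.

Set Implicit Arguments.
Unset Strict Implicit.
Unset Printing Implicit Defensive.

Import Order.TTheory GRing.Theory Num.Theory.
Import numFieldNormedType.Exports.

Local Open Scope classical_set_scope.
Local Open Scope ring_scope.

Section Smoothness.
Context {R : realType} {V W : normedModType R}.

(* [U] is meant to be open; [V] is finite-dimensional in all uses below. *)
Fixpoint Ck (k : nat) (U : set V) (f : V -> W) : Prop :=
  if k is k'.+1 then
    (forall x, U x -> differentiable f x) /\ forall v, Ck k' U ('D_v f)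
  else forall x, U x -> {for x, continuous f}.

Definition Cinf (U : set V) (f : V -> W) : Prop := forall k, Ck k U f.

End Smoothness.

(* A chart is a total map, of which only the restriction to [cdom] matters. *)
Record chart (R : realType) (X : Type) (m : nat) := Chart {
  cdom : set X;
  cmap : X -> 'rV[R]_m }.

Section Manifold.
Context {R : realType} {n : nat} {M : topologicalType}.

Definition topological_chart (c : chart R M n) : Prop :=
  [/\ open (cdom c),
      forall p q, cdom c p -> cdom c q -> cmap c p = cmap c q -> p = q,
      forall p, cdom c p -> {for p, continuous (cmap c)} &
      forall V, open V -> V `<=` cdom c -> open (cmap c @` V)].

Definition smooth_transition (c d : chart R M n) : Prop :=
  exists h : 'rV[R]_n -> 'rV[R]_n,
    Cinf (cmap c @` (cdom c `&` cdom d)) h /\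
    forall p, cdom c p -> cdom d p -> h (cmap c p) = cmap d p.

Definition smooth_manifold (A : set (chart R M n)) : Prop :=
  [/\ hausdorff_space M, @second_countable M,
      forall c, A c -> topological_chart c,
      forall p, exists2 c, A c & cdom c p &
      forall c d, A c -> A d -> smooth_transition c d].

End Manifold.

(* Functions and tangent vectors on the manifold carried by the union of the
   domains of the charts of [A], a subset of [X]: nothing below depends on the
   values of functions outside that subset. *)
Section Tangent.
Context {R : realType} {X : Type} {m : nat}.
Variable A : set (chart R X m).

Definition of_class (P : set 'rV[R]_m -> ('rV[R]_m -> R) -> Prop)
    (p : X) (f : X -> R) : Prop :=
  forall c, A c -> cdom c p -> exists (W : set 'rV[R]_m) (h : 'rV[R]_m -> R),
    [/\ open W, W (cmap c p), P W h &
        forall q, cdom c q -> W (cmap c q) -> f q = h (cmap c q)].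

Definition smooth_at : X -> (X -> R) -> Prop := of_class Cinf.

Definition Ck_at (k : nat) : X -> (X -> R) -> Prop := of_class (Ck k).

Definition smooth_function (f : X -> R) : Prop :=
  forall c p, A c -> cdom c p -> smooth_at p f.

Definition same_germ (p : X) (f g : X -> R) : Prop :=
  exists2 c, A c /\ cdom c p & exists W : set 'rV[R]_m,
    [/\ open W, W (cmap c p) &
        forall q, cdom c q -> W (cmap c q) -> f q = g q].

Definition tvec : Type := (X -> R) -> R.

(* The tangent space at [p]: derivations of the algebra of germs at [p] of
   smooth functions, extended by 0 to the functions that are not smooth near
   [p] so that equality of maps is equality of tangent vectors. The tangent
   space is a subspace of the vector space of all maps [(X -> R) -> R]. *)
Definition tangent (p : X) (v : (X -> R) -> R) : Prop :=
  [/\ forall f, ~ smooth_at p f -> v f = 0,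
      forall f g, same_germ p f g -> v f = v g,
      forall (a : R) f g, smooth_at p f -> smooth_at p g ->
        v (fun q => a * f q + g q) = a * v f + v g &
      forall f g, smooth_at p f -> smooth_at p g ->
        v (fun q => f q * g q) = f p * v g + g p * v f].

Definition on_germs (p : X) (v : (X -> R) -> R) : (X -> R) -> R :=
  fun f => if `[< smooth_at p f >] then v f else 0.

Definition velocity (c : R -> X) (t : R) : (X -> R) -> R :=
  on_germs (c t) (fun f => derive1 (f \o c) t).

End Tangent.

Section TangentBundle.
Context {R : realType} {n : nat} {M : topologicalType}.
Variable A : set (chart R M n).

(* [bundle] is only the carrier of TM (the set [TM]) and of the bundle of
   nonzero tangent vectors (the set [TM0]); the projection pi is [fst]. *)
Local Notation vec := ((M -> R) -> R).
Definition bundle : Type := (M * ((M -> R) -> R))%type.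

Definition TM : set bundle := [set u | tangent A u.1 u.2].

Definition TM0 : set bundle := [set u | tangent A u.1 u.2 /\ u.2 <> 0].

(* (x^i, y^i), where y^i = v(x^i) *)
Definition induced_coordinates (c : chart R M n) (u : bundle) :
    'rV[R]_(n + n) :=
  row_mx (cmap c u.1) (\row_i u.2 (fun q => cmap c q 0 i)).

Definition TM_atlas : set (chart R bundle (n + n)) :=
  [set Chart (TM `&` [set u | cdom c u.1]) (induced_coordinates c) | c in A].

Definition TM0_atlas : set (chart R bundle (n + n)) :=
  [set Chart (TM0 `&` [set u | cdom c u.1]) (induced_coordinates c) | c in A].

Local Notation dvec := ((bundle -> R) -> R).

Definition tangent0 (u : bundle) (xi : dvec) : Prop := tangent TM0_atlas u xi.

Definition vector_field (X : bundle -> dvec) : Prop :=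
  (forall u, TM0 u -> tangent0 u (X u)) /\
  forall u F, TM0 u -> smooth_at TM0_atlas u F ->
    smooth_at TM0_atlas u (fun w => X w F).

(* The fibre of pi^{-1}(TM) over u is the tangent space of M at pi(u). *)
Definition pi_vector_field (Y : bundle -> vec) : Prop :=
  (forall u, TM0 u -> tangent A u.1 (Y u)) /\
  forall u f, TM0 u -> smooth_at A u.1 f ->
    smooth_at TM0_atlas u (fun w => Y w f).

Definition bracket (X Y : bundle -> dvec) (u : bundle) : dvec :=
  on_germs TM0_atlas u
    (fun F => X u (fun w => Y w F) - Y u (fun w => X w F)).

Definition etabar (u : bundle) : vec := u.2.

(* Derivative at u of F along the fibre of TM through u, in the direction v;
   for v the i-th vector of the natural frame of a chart it is the partial
   derivative of F with respect to y^i. *)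
Definition fibre_derivative (v : vec) (F : bundle -> R) (u : bundle) : R :=
  derive1 (fun t : R => F (u.1, u.2 + t *: v)) 0.

Definition vertical_lift (u : bundle) (v : vec) : dvec :=
  on_germs TM0_atlas u (fun F => fibre_derivative v F u).

Definition rho_map (u : bundle) (xi : dvec) : vec :=
  on_germs A u.1 (fun f => xi (f \o fst)).

Definition liouville (u : bundle) : dvec := vertical_lift u (etabar u).

End TangentBundle.

Section Connections.
Context {R : realType} {n : nat} {M : topologicalType}.
Variable A : set (chart R M n).

Local Notation vec := ((M -> R) -> R).
Local Notation bun := (@bundle R M).
Local Notation dvec := ((bun -> R) -> R).

(* [nabla u xi Y] is the covariant derivative at u, in the direction of the
   tangent vector xi of TM0 at u, of the pi-vector field Y. *)
Definition connection_operator : Type := bun -> dvec -> (bun -> vec) -> vec.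

Record linear_connection (nabla : connection_operator) : Prop := {
  conn_tangent : forall u xi Y, TM0 A u -> tangent0 A u xi ->
    pi_vector_field A Y -> tangent A u.1 (nabla u xi Y);
  conn_restrict : forall u xi Y Z, TM0 A u -> tangent0 A u xi ->
    pi_vector_field A Y -> pi_vector_field A Z ->
    (forall w, TM0 A w -> Y w = Z w) -> nabla u xi Y = nabla u xi Z;
  conn_linear : forall u (a : R) xi zeta Y, TM0 A u -> tangent0 A u xi ->
    tangent0 A u zeta -> pi_vector_field A Y ->
    nabla u (a *: xi + zeta) Y = a *: nabla u xi Y + nabla u zeta Y;
  conn_add : forall u xi Y Z, TM0 A u -> tangent0 A u xi ->
    pi_vector_field A Y -> pi_vector_field A Z ->
    nabla u xi (fun w => Y w + Z w) = nabla u xi Y + nabla u xi Z;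
  conn_leibniz : forall u xi F Y, TM0 A u -> tangent0 A u xi ->
    smooth_function (TM0_atlas A) F -> pi_vector_field A Y ->
    nabla u xi (fun w => F w *: Y w) = xi F *: Y u + F u *: nabla u xi Y;
  conn_smooth : forall X Y, vector_field A X -> pi_vector_field A Y ->
    pi_vector_field A (fun u => nabla u (X u) Y) }.

Variable nabla : connection_operator.

Definition deflection (u : bun) (xi : dvec) : vec := nabla u xi etabar.

Definition regular : Prop :=
  linear_connection nabla /\
  forall u xi, TM0 A u -> tangent0 A u xi ->
    exists! z : dvec * dvec,
      [/\ tangent0 A u z.1 /\ rho_map A u z.1 = 0,
          tangent0 A u z.2 /\ deflection u z.2 = 0 &
          xi = z.1 + z.2].

(* the inverse of the restriction of [rho_map A u] to the kernel of the
   deflection map at u *)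
Definition beta_map (u : bun) (v : vec) : dvec :=
  xget 0 [set xi |
    [/\ tangent0 A u xi, deflection u xi = 0 & rho_map A u xi = v]].

Definition torsion (X Y : bun -> dvec) (u : bun) : vec :=
  nabla u (X u) (fun w => rho_map A w (Y w))
  - nabla u (Y u) (fun w => rho_map A w (X w))
  - rho_map A u (bracket A X Y u).

Definition h_torsion (X Y : bun -> vec) : bun -> vec :=
  torsion (fun u => beta_map u (X u)) (fun u => beta_map u (Y u)).

Definition mixed_torsion (X Y : bun -> vec) : bun -> vec :=
  torsion (fun u => vertical_lift A u (X u)) (fun u => beta_map u (Y u)).

End Connections.

Section Finsler.
Context {R : realType} {n : nat} {M : topologicalType}.
Variable A : set (chart R M n).

Local Notation vec := ((M -> R) -> R).
Local Notation bun := (@bundle R M).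

Variable L : bun -> R.

(* g_u(v, w) = (1/2) d_v d_w L^2 (u), with d_v and d_w taken along the fibre.
   It is bilinear on the tangent space at pi(u), and its components in the
   natural frame of a chart are the (1/2) d^2 L^2 / dy^i dy^j. *)
Definition finsler_g (u : bun) (v w : vec) : R :=
  2^-1 * fibre_derivative v (fibre_derivative w (fun z => L z ^+ 2)) u.

(* C^1 regularity at the zero section is required of L^2: a nonnegative L with
   C.L = L that is itself C^1 along the zero section is linear on the fibres,
   hence identically 0, and then g is not positive definite. Requiring it of
   L^2 is weaker than requiring it of L, and includes the continuity of L. *)
Record finsler : Prop := {
  finsler_ge0 : forall u, TM A u -> 0 <= L u;
  finsler_zero : forall p, L (p, 0) = 0;
  finsler_smooth : smooth_function (TM0_atlas A) L;
  finsler_C1 : forall u, TM A u -> Ck_at (TM_atlas A) 1 u (fun z => L z ^+ 2);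
  finsler_homogeneous : forall u, TM0 A u -> liouville A u L = L u;
  finsler_posdef : forall u v, TM0 A u -> tangent A u.1 v -> v <> 0 ->
    0 < finsler_g u v v }.

Definition metrical (nabla : connection_operator) : Prop :=
  forall u xi Y Z, TM0 A u -> tangent0 A u xi ->
    pi_vector_field A Y -> pi_vector_field A Z ->
    xi (fun w => finsler_g w (Y w) (Z w))
    - finsler_g u (nabla u xi Y) (Z u) - finsler_g u (Y u) (nabla u xi Z) = 0.

Definition cartan_connection (nabla : connection_operator) : Prop :=
  [/\ regular A nabla,
      metrical nabla,
      forall X Y, pi_vector_field A X -> pi_vector_field A Y ->
        forall u, TM0 A u -> h_torsion A nabla X Y u = 0 &
      forall X Y Z, pi_vector_field A X -> pi_vector_field A Y ->
        pi_vector_field A Z -> forall u, TM0 A u ->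
        finsler_g u (mixed_torsion A nabla X Y u) (Z u)
        = finsler_g u (mixed_torsion A nabla X Z u) (Y u)].

End Finsler.

Section Curves.
Context {R : realType} {n : nat} {M : topologicalType}.
Variable A : set (chart R M n).

Local Notation vec := ((M -> R) -> R).
Local Notation bun := (@bundle R M).

(* [I] is an open interval; the values of [c] outside [I] are irrelevant. *)
Definition smooth_curve (I : set R) (c : R -> M) : Prop :=
  forall t, I t -> {for t, continuous c} /\
    forall d, A d -> cdom d (c t) ->
      exists2 J : set R, open J /\ J t & Cinf J (cmap d \o c).

Definition regular_curve (I : set R) (c : R -> M) : Prop :=
  smooth_curve I c /\ forall t, I t -> velocity A c t <> 0.

Definition canonical_lift (c : R -> M) (t : R) : bun := (c t, velocity A c t).

(* D/dt along [chat] of the restriction to [chat] of the pi-vector field Y *)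
Definition covariant_derivative (nabla : connection_operator)
    (chat : R -> bun) (Y : bun -> vec) (t : R) : vec :=
  nabla (chat t) (velocity (TM0_atlas A) chat t) Y.

Definition geodesic (nabla : connection_operator) (I : set R) (c : R -> M) :
    Prop :=
  regular_curve I c /\
  forall t, I t -> covariant_derivative nabla (canonical_lift c) etabar t = 0.

Variables nabla nablat : connection_operator (R := R) (M := M).

Definition omega (u : bun) (xi : (bun -> R) -> R) (Y : bun -> vec) : vec :=
  nablat u xi Y - nabla u xi Y.

Definition B_tensor (X Y : bun -> vec) (u : bun) : vec :=
  omega u (beta_map A nabla u (X u)) Y.

End Curves.

(* Main.v *)
Require Import Defs.
From HB Require Import structures.
From mathcomp Require Import all_boot all_order all_algebra.
From mathcomp Require Import all_classical all_reals all_analysis.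

(** Let xi be the velocity of the canonical lift of a regular curve c at t, a
    tangent vector of the slit tangent bundle at u = (c t, dc/dt). Projecting
    the lift back to M recovers c, so rho xi = dc/dt = etabar u. By definition
    c is a geodesic of a connection exactly when xi is horizontal for it, i.e.
    when its deflection map K kills xi.

    A regular connection has, over each vector in the range of rho, exactly one
    horizontal vector: two of them differ by a vertical vector, and
    T = ker rho (+) ker K. Hence if c is a geodesic of nabla, then
    xi = beta etabar, and B(etabar, etabar) = nablat_xi etabar
    - nabla_xi etabar = nablat_xi etabar, which vanishes iff c is a geodesic of
    nablat. If instead c is a geodesic of nablat and B(etabar, etabar) = 0, then
    beta etabar is horizontal for both connections; it and xi are both
    nablat-horizontal over etabar, so they agree and xi is nabla-horizontal.
    This linear algebra is [omega_beta_eq0].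

    What remains is to show that xi really is tangent to the slit tangent
    bundle ([tangent0_lift]) and that rho xi = dc/dt ([rho_velocity_lift]).
    Tangent vectors are derivations depending only on germs, and a germ may be
    taken in any chart, so the first point requires the coordinate changes
    (x, y) |-> (x', y') of the slit bundle to be continuous
    ([compatible_charts_slit]): y' must be the derivative of the change of
    coordinates x' = h(x) in the direction y ([induced_transition]). The usual
    argument for this formula is Hadamard's lemma, which gives that a derivation
    killing the coordinate functions is zero. Here positive definiteness of the
    fundamental tensor gives it at once ([finsler_coord_inj]): near a point u,
    L is a function of the coordinates (x, y), hence it is constant along
    u + t v when v kills the coordinate functions, whence g_u(v, v) = 0 and
    v = 0. A tangent vector is then the velocity of the coordinate line with
    the same components, and velocities obey the chain rule. *)

Set Implicit Arguments.
Unset Strict Implicit.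
Unset Printing Implicit Defensive.

Import Order.TTheory GRing.Theory Num.Theory.
Import numFieldNormedType.Exports.

Local Open Scope classical_set_scope.
Local Open Scope ring_scope.

(** * Calculus of C^k maps on open sets *)

Section Calculus.
Context {R : realType} {V W : normedModType R}.

(** The difference of the two functions vanishes near [x], hence is a little-o
    and has differential 0 there. *)
Lemma near_eq_differentiable (f g : V -> W) (x : V) :
  {near x, f =1 g} -> differentiable f x -> differentiable g x.
Proof.
move=> fg df.
pose e := g - f.
have e0 : \forall y \near x, e y = 0.
  by apply: filterS fg => y fgy; rewrite /e !fctE fgy subrr.
have eo : e \o shift x = cst (e x) + \0 +o_ 0 id.
  apply/eqaddoP => _/posnumP[k].
  have : \forall y \near (0 : V), e (y + x) = 0.
    by move: e0; rewrite (near_shift 0 x) subr0.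
  apply: filterS => y /= ey.
  by rewrite !fctE /= ey (nbhs_singleton e0) addr0 subr0 normr0 mulr_ge0.
have de : differentiable e x.
  have z : 'd e x = \0 :> (V -> W).
    by apply: (@diff_unique _ _ _ _ \0) => // y; exact: cvg_cst.
  apply/diff_locallyP; rewrite z; split=> // y; exact: cvg_cst.
have -> : g = f + e by rewrite /e addrC subrK.
exact: differentiableD.
Qed.

Lemma Ck_continuous k (U : set V) (f : V -> W) :
  Ck k U f -> forall x, U x -> {for x, continuous f}.
Proof. by case: k => // k [+ _] x Ux => /(_ x Ux)/differentiable_continuous. Qed.

Lemma CkW k (U : set V) (f : V -> W) : Ck k.+1 U f -> Ck k U f.
Proof.
elim: k f => [|k IH] f; first exact: Ck_continuous.
by move=> [df Df]; split=> // v; exact: IH.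
Qed.

Lemma subset_Ck k (U U' : set V) (f : V -> W) :
  U' `<=` U -> Ck k U f -> Ck k U' f.
Proof.
move=> s; elim: k f => [|k IH] f /=; first by move=> h x /s; exact: h.
by move=> [df Df]; split=> [x /s|v]; [exact: df|exact: IH].
Qed.

Lemma eq_Ck k (U : set V) (f g : V -> W) : open U ->
  (forall x, U x -> f x = g x) -> Ck k U f -> Ck k U g.
Proof.
move=> oU; elim: k f g => [|k IH] f g fg /=.
  move=> cf x Ux; rewrite /prop_for /continuous_at -(fg x Ux).
  apply: cvg_trans (cf x Ux).
  apply: near_eq_cvg; near=> y; apply: fg; near: y; exact: open_nbhs_nbhs.
have fgn x : U x -> {near x, f =1 g}.
  by move=> Ux; near=> y; apply: fg; near: y; exact: open_nbhs_nbhs.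
move=> [df Df]; split=> [x Ux|v].
  by apply: near_eq_differentiable (df x Ux); exact: fgn.
apply: IH (Df v) => x Ux; apply: near_eq_derive; exact: fgn.
Unshelve. all: by end_near. Qed.

Lemma CkD k (U : set V) (f g : V -> W) : open U ->
  Ck k U f -> Ck k U g -> Ck k U (f + g).
Proof.
move=> oU; elim: k f g => [|k IH] f g /=.
  by move=> cf cg x Ux; apply: continuousD; [exact: cf|exact: cg].
move=> [df Df] [dg Dg]; split=> [x Ux|v].
  by apply: differentiableD; [exact: df|exact: dg].
apply: (@eq_Ck _ _ ('D_v f + 'D_v g)) => //; last exact: IH.
by move=> x Ux; rewrite deriveD//; apply: diff_derivable; [exact: df|exact: dg].
Qed.

Lemma CkZ k (U : set V) a (f : V -> W) : open U ->
  Ck k U f -> Ck k U (a *: f).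
Proof.
move=> oU; elim: k f => [|k IH] f /=.
  by move=> cf x Ux; apply: continuousZl_tmp; exact: cf.
move=> [df Df]; split=> [x Ux|v].
  by apply: differentiableZ; exact: df.
apply: (@eq_Ck _ _ (a *: 'D_v f)) => //; last exact: IH.
by move=> x Ux; rewrite deriveZ//; apply: diff_derivable; exact: df.
Qed.

End Calculus.

Lemma CkM {R : realType} {V : normedModType R} k (U : set V) (f g : V -> R) :
  open U -> Ck k U f -> Ck k U g -> Ck k U (f * g).
Proof.
move=> oU; elim: k f g => [|k IH] f g.
  by move=> cf cg x Ux; apply: continuousM; [exact: cf|exact: cg].
move=> cf cg; have [df Df] := cf; have [dg Dg] := cg; split=> [x Ux|v].
  by apply: differentiableM; [exact: df|exact: dg].
apply: (@eq_Ck _ _ _ _ _ (f * 'D_v g + g * 'D_v f)) => //.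
  move=> x Ux; rewrite deriveM//; apply: diff_derivable; [exact: df|exact: dg].
have [cf' cg'] := (CkW cf, CkW cg).
by apply: CkD => //; [exact: IH cf' (Dg v)|exact: IH cg' (Df v)].
Qed.

Section Linear.
Context {R : realType} {V V' W : normedModType R}.

(** A directional derivative of [f \o l] is a directional derivative of [f]
    composed with [l], even where neither exists: the difference quotients are
    the same. This is what keeps the induction within functions of the form
    [g \o l]. *)
Lemma Ck_comp_linear k (U : set V') (l : {linear V -> V'}) (f : V' -> W) :
  continuous l -> Ck k U f -> Ck k (l @^-1` U) (f \o l).
Proof.
move=> cl; elim: k f => [|k IH] f /=.
  by move=> cf x Ux; apply: continuous_comp; [exact: cl|exact: cf].
move=> [df Df]; split=> [x Ux|v].
  apply: differentiable_comp; last exact: df.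
  exact: linear_differentiable.
suff -> : 'D_v (f \o l) = 'D_(l v) f \o l by exact: IH (Df (l v)).
apply/funext => x; rewrite /derive /=.
set q := fun h => _; set q' := fun h => _; suff -> : q = q' by [].
by apply/funext => h; rewrite /q /q' /= (linearP l).
Qed.

Lemma Ck_linear_comp k (U : set V) (l : {linear V' -> W}) (f : V -> V') :
  open U -> continuous l -> Ck k U f -> Ck k U (l \o f).
Proof.
move=> oU cl; elim: k f => [|k IH] f /=.
  by move=> cf x Ux; apply: continuous_comp; [exact: cf|exact: cl].
move=> [df Df]; split=> [x Ux|v].
  apply: differentiable_comp; first exact: df.
  exact: linear_differentiable.
apply: (@eq_Ck _ _ _ _ _ (l \o 'D_v f)) => //; last exact: IH.
move=> x Ux; rewrite deriveE; last first.
  by apply: differentiable_comp; [exact: df|exact: linear_differentiable].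
rewrite /= deriveE; last exact: df.
rewrite (@diff_comp _ _ _ _ f l); [|exact: df|exact: linear_differentiable].
by rewrite /= (diff_lin (f x) (@cl)).
Qed.
End Linear.

Section Matrices.
Context {R : realType}.

Lemma Ck_coord {V : normedModType R} {m n} k (U : set V)
    (f : V -> 'M[R]_(m, n)) i j :
  open U -> Ck k U f -> Ck k U (fun x => f x i j).
Proof.
move=> oU cf.
have lc : linear (fun N : 'M[R]_(m, n) => N i j : R).
  by move=> a A B; rewrite !mxE.
pose lM := GRing.isLinear.Build _ _ _ _ _ lc.
pose l : {linear _ -> _} := HB.pack (fun N : 'M[R]_(m, n) => N i j : R) lM.
apply: (@Ck_linear_comp _ _ _ _ _ _ l) => //.
exact: coord_continuous.
Qed.

Lemma continuous_mx {V : topologicalType} {m n} (f : V -> 'M[R]_(m, n)) x :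
  (forall i j, {for x, continuous (fun z => f z i j)}) -> {for x, continuous f}.
Proof.
move=> cf; apply/cvgrPdist_le => /= e e0.
near=> z.
rewrite /Num.Def.normr/= mx_normrE (bigmax_le _ (ltW e0))//= => i _.
rewrite !mxE/=.
move: i; near: z; apply: filter_forall => /= i.
exact: ((cvgrPdist_le _ _).1 (cf i.1 i.2)).
Unshelve. all: by end_near. Qed.

End Matrices.

(** * Derivations on a manifold given by an atlas *)

Section Atlas.
Context {R : realType} {X : Type} {m : nat}.
Variable A : set (chart R X m).

(** Continuity at [p] of the changes of coordinates of [A], with the domains
    included, in a form that makes sense when [X] has no topology. It is what
    lets one choose the chart in which a germ is examined. *)
Definition compatible_charts_at (p : X) : Prop :=
  forall c d, A c -> A d -> cdom c p -> cdom d p ->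
  forall W, open W -> W (cmap c p) -> exists W' : set 'rV[R]_m,
    [/\ open W', W' (cmap d p) &
        forall q, cdom d q -> W' (cmap d q) -> cdom c q /\ W (cmap c q)].

(** The first condition excludes points outside the manifold carried by [A],
    where the second one would be void. *)
Definition differentiable_curve_at (c : R -> X) (t : R) : Prop :=
  (exists2 d, A d & cdom d (c t)) /\
  forall d, A d -> cdom d (c t) ->
    (\forall s \near t, cdom d (c s)) /\ derivable (cmap d \o c) t 1.

Lemma same_germ_sym p f g : same_germ A p f g -> same_germ A p g f.
Proof.
move=> [c Ac [W [oW Wp fg]]]; exists c => //.
by exists W; split=> // q cq Wq; rewrite fg.
Qed.

Lemma same_germ_smooth_at p f g : compatible_charts_at p ->
  same_germ A p f g -> smooth_at A p f -> smooth_at A p g.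
Proof.
move=> comp [c [Ac cp] [W [oW Wp fg]]] sf d Ad dp.
have [W1 [oW1 W1p W1W]] := comp c d Ac Ad cp dp W oW Wp.
have [W2 [h [oW2 W2p Ch fh]]] := sf d Ad dp.
exists (W1 `&` W2), h; split => //; first exact: openI.
  by move=> k; apply: subset_Ck (Ch k) => x [].
move=> q dq [W1q W2q]; have [cq Wq] := W1W q dq W1q.
by rewrite -fg// fh.
Qed.

Lemma smooth_at_linear p (a : R) f g : smooth_at A p f -> smooth_at A p g ->
  smooth_at A p (fun q => a * f q + g q).
Proof.
move=> sf sg c Ac cp.
have [W1 [h1 [oW1 W1p C1 fh]]] := sf c Ac cp.
have [W2 [h2 [oW2 W2p C2 gh]]] := sg c Ac cp.
have oW : open (W1 `&` W2) by exact: openI.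
exists (W1 `&` W2), (a *: h1 + h2); split => //.
  move=> k; apply: CkD => //; first apply: CkZ => //.
    by apply: subset_Ck (C1 k) => x [].
  by apply: subset_Ck (C2 k) => x [].
by move=> q cq [W1q W2q]; rewrite fh// gh.
Qed.

Lemma smooth_atM p f g : smooth_at A p f -> smooth_at A p g ->
  smooth_at A p (fun q => f q * g q).
Proof.
move=> sf sg c Ac cp.
have [W1 [h1 [oW1 W1p C1 fh]]] := sf c Ac cp.
have [W2 [h2 [oW2 W2p C2 gh]]] := sg c Ac cp.
have oW : open (W1 `&` W2) by exact: openI.
exists (W1 `&` W2), (h1 * h2); split => //.
  move=> k; apply: CkM => //.
    by apply: subset_Ck (C1 k) => x [].
  by apply: subset_Ck (C2 k) => x [].
by move=> q cq [W1q W2q]; rewrite fh// gh.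
Qed.

Lemma near_chart_curve (c : R -> X) t d (W : set 'rV[R]_m) :
  differentiable_curve_at c t -> A d -> cdom d (c t) ->
  open W -> W (cmap d (c t)) ->
  \forall s \near t, cdom d (c s) /\ W (cmap d (c s)).
Proof.
move=> [_ cc] Ad dp oW Wp; have [ds /derivable1_diffP dc] := cc d Ad dp.
near=> s; split; first by near: s.
near: s; apply: (differentiable_continuous dc).
exact: open_nbhs_nbhs.
Unshelve. all: by end_near. Qed.

Lemma derivable_smooth_curve (c : R -> X) t f :
  differentiable_curve_at c t -> smooth_at A (c t) f -> derivable (f \o c) t 1.
Proof.
move=> dc sf; have [[d Ad dp] cc] := dc.
have [W [h [oW Wp Ch fh]]] := sf d Ad dp.
have [_ /derivable1_diffP ddc] := cc d Ad dp.
apply: (@near_eq_derivable _ _ _ (h \o (cmap d \o c))).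
  apply: filterS (near_chart_curve dc Ad dp oW Wp) => s [ds Ws] /=.
  by rewrite fh.
apply/derivable1_diffP; apply: differentiable_comp => //.
by have [+ _] := Ch 1%N; apply.
Qed.

(** Compatibility of the charts enters through [on_germs]: a function must not
    be smooth while another one with the same germ is not. *)
Lemma tangent_velocity (c : R -> X) t :
  compatible_charts_at (c t) -> differentiable_curve_at c t ->
  tangent A (c t) (velocity A c t).
Proof.
move=> comp dc; rewrite /velocity /on_germs; split.
- by move=> f nsf; rewrite asboolF.
- move=> f g fg; have [sf|nsf] := pselect (smooth_at A (c t) f).
    rewrite !asboolT//; last exact: same_germ_smooth_at fg sf.
    rewrite !derive1E; apply: near_eq_derive.
    have [d [Ad dp] [W [oW Wp {}fg]]] := fg.
    apply: filterS (near_chart_curve dc Ad dp oW Wp) => s [ds Ws] /=.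
    exact: fg.
  rewrite !asboolF// => sg; apply: nsf.
  exact: same_germ_smooth_at (same_germ_sym fg) sg.
- move=> a f g sf sg; rewrite !asboolT//; last exact: smooth_at_linear.
  have df := derivable_smooth_curve dc sf.
  have dg := derivable_smooth_curve dc sg.
  rewrite !derive1E (_ : _ \o c = a *: (f \o c) + (g \o c))//.
  by rewrite deriveD ?deriveZ//; exact: derivableZ.
- move=> f g sf sg; rewrite !asboolT//; last exact: smooth_atM.
  have df := derivable_smooth_curve dc sf.
  have dg := derivable_smooth_curve dc sg.
  by rewrite !derive1E (_ : _ \o c = (f \o c) * (g \o c))// deriveM.
Qed.

Lemma tangent_lin p (a : R) v w : tangent A p v -> tangent A p w ->
  tangent A p (a *: v + w).
Proof.
move=> [v0 vg vl vm] [w0 wg wl wm].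
have vwE f : (a *: v + w) f = a * v f + w f by [].
split.
- by move=> f nf; rewrite vwE v0// w0// mulr0 addr0.
- by move=> f g fg; rewrite !vwE (vg _ _ fg) (wg _ _ fg).
- move=> b f g sf sg; rewrite !vwE vl// wl//.
  by rewrite !mulrDr mulrCA addrACA.
- move=> f g sf sg; rewrite !vwE vm// wm//.
  by rewrite !mulrDr ![a * (_ * _)]mulrCA addrACA.
Qed.

Lemma tangent_zero p : tangent A p 0.
Proof.
split=> //.
- by move=> a f g _ _; rewrite /= [RHS]addr0 mulr0.
- by move=> f g _ _; rewrite /= !mulr0 addr0.
Qed.

Lemma tangentB p v w : tangent A p v -> tangent A p w -> tangent A p (v - w).
Proof.
by move=> tv tw; rewrite addrC -scaleN1r; exact: tangent_lin.
Qed.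

End Atlas.

(** * Charts, transition maps and coordinate lines *)

Section ManifoldCharts.
Context {R : realType} {n : nat} {M : topologicalType}.
Variable A : set (chart R M n).
Hypothesis hM : smooth_manifold A.

Lemma topological_chart_of c : A c -> topological_chart c.
Proof. by have [_ _ + _ _] := hM; exact. Qed.

Lemma chart_at p : exists2 d, A d & cdom d p.
Proof. by have [_ _ _ + _] := hM; exact. Qed.

Lemma open_cdom c : A c -> open (cdom c).
Proof. by move=> /topological_chart_of[]. Qed.

Lemma cmap_inj c p q : A c -> cdom c p -> cdom c q ->
  cmap c p = cmap c q -> p = q.
Proof. by move=> /topological_chart_of[_ + _ _]; exact. Qed.

Lemma open_chart_preimage c (W : set 'rV[R]_n) : A c -> open W ->
  open (cdom c `&` cmap c @^-1` W).
Proof.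
move=> /topological_chart_of[oc _ cc _] oW.
rewrite openE => p [cp Wp]; apply: filterI; first exact: open_nbhs_nbhs.
by apply: cc => //; exact: open_nbhs_nbhs.
Qed.

Definition overlap (c d : chart R M n) := cmap c @` (cdom c `&` cdom d).

Lemma open_overlap c d : A c -> A d -> open (overlap c d).
Proof.
move=> Ac Ad; have [oc _ _ openc] := topological_chart_of Ac.
by apply: openc => [|p []//]; apply: openI => //; exact: open_cdom.
Qed.

Lemma mem_overlap c d p : A c -> cdom c p -> overlap c d (cmap c p) -> cdom d p.
Proof.
move=> Ac cp [q [cq dq] eqpq].
by rewrite -(cmap_inj Ac cq cp eqpq).
Qed.

Lemma compatible_charts_manifold p : compatible_charts_at A p.
Proof.
move=> c d Ac Ad cp dp W oW Wp.
have [_ _ _ opend] := topological_chart_of Ad.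
pose N := (cdom c `&` cmap c @^-1` W) `&` cdom d.
exists (cmap d @` N); split.
- apply: opend => [|q []//].
  by apply: openI; [exact: open_chart_preimage|exact: open_cdom].
- by exists p.
- move=> q dq [q' [[cq' Wq'] dq'] e].
  by rewrite -(cmap_inj Ad dq' dq e).
Qed.

Lemma transition_map c d : A c -> A d ->
  exists h, Cinf (overlap c d) h /\
    forall p, cdom c p -> cdom d p -> h (cmap c p) = cmap d p.
Proof. by move=> Ac Ad; have [_ _ _ _] := hM; exact. Qed.

Lemma smooth_at_coord d p i : A d -> cdom d p ->
  smooth_at A p (fun q => cmap d q 0 i).
Proof.
move=> Ad dp c Ac cp; have [h [Ch hE]] := transition_map Ac Ad.
exists (overlap c d), (fun x => h x 0 i); split.
- exact: open_overlap.
- by exists p.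
- by move=> k; apply: Ck_coord; [exact: open_overlap|exact: Ch].
- by move=> q cq /(mem_overlap Ac cq) dq; rewrite hE.
Qed.

Lemma smooth_curve_differentiable (I : set R) (c : R -> M) t :
  smooth_curve A I c -> I t -> differentiable_curve_at A c t.
Proof.
move=> sc It; have [cc cd] := sc t It; split; first exact: chart_at.
move=> d Ad dp; split.
  by apply: cc; apply: open_nbhs_nbhs; split => //; exact: open_cdom.
have [J [oJ Jt] CJ] := cd d Ad dp.
by apply/derivable1_diffP; have [+ _] := CJ 1%N; exact.
Qed.

(** Meaningful only while the segment stays in the image of the chart [e],
    that is for [s] near 0. *)
Definition coordinate_line (e : chart R M n) (p : M) (y : 'rV[R]_n) (s : R) :
    M :=
  xget p [set q | cdom e q /\ cmap e q = s *: y + cmap e p].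

Lemma near_coordinate_line e d p y : A e -> A d -> cdom e p -> cdom d p ->
  \forall s \near (0 : R), [/\ cdom e (coordinate_line e p y s),
    cdom d (coordinate_line e p y s) &
    cmap e (coordinate_line e p y s) = s *: y + cmap e p].
Proof.
move=> Ae Ad ep dp.
have cl : {for 0, continuous (fun s : R => s *: y + cmap e p)}.
  by apply: continuousD; [exact: scalel_continuous|exact: cvg_cst].
have : \forall s \near (0 : R), overlap e d (s *: y + cmap e p).
  apply: cl; rewrite /= scale0r add0r; apply: open_nbhs_nbhs.
  by split; [exact: open_overlap|exists p].
apply: filterS => s [q [eq dq] qE].
have [el lE] : [set q | cdom e q /\ cmap e q = s *: y + cmap e p]
    (coordinate_line e p y s) by apply: (xgetI _ (x := q)).
split=> //; suff <- : q = coordinate_line e p y s by [].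
by apply: (cmap_inj Ae) => //; rewrite qE.
Qed.

Lemma coordinate_line0 e p y : A e -> cdom e p -> coordinate_line e p y 0 = p.
Proof.
move=> Ae ep; have [el _ lE] := nbhs_singleton (near_coordinate_line y Ae Ae ep ep).
by apply: (cmap_inj Ae) => //; rewrite lE scale0r add0r.
Qed.

Lemma derive_line (f : 'rV[R]_n -> 'rV[R]_n) x y :
  'D_1 (fun s : R => f (s *: y + x)) 0 = 'D_y f x.
Proof.
rewrite /derive /=.
set q := fun h => _; set q' := fun h => _; suff -> : q = q' by [].
by apply/funext => h; rewrite /q /q' /= addr0 scale0r add0r [_%:A]mulr1.
Qed.

Section Line.
Variables (e d : chart R M n) (p : M) (y : 'rV[R]_n) (h : 'rV[R]_n -> 'rV[R]_n).
Hypotheses (Ae : A e) (Ad : A d) (ep : cdom e p) (dp : cdom d p).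
Hypothesis Ch : Cinf (overlap e d) h.
Hypothesis hE : forall q, cdom e q -> cdom d q -> h (cmap e q) = cmap d q.

Lemma coordinate_line_transition :
  \forall s \near (0 : R), h (s *: y + cmap e p) = cmap d (coordinate_line e p y s).
Proof.
apply: filterS (near_coordinate_line y Ae Ad ep dp) => s [es ds lE].
by rewrite -lE hE.
Qed.

Lemma derivable_coordinate_line : derivable (cmap d \o coordinate_line e p y) 0 1.
Proof.
have dh : differentiable h (cmap e p) by have [+ _] := Ch 1%N; apply; exists p.
apply: (@near_eq_derivable _ _ _ (fun s : R => h (s *: y + cmap e p))).
  exact: coordinate_line_transition.
by have /derivable1P := @diff_derivable _ _ _ _ _ y dh.
Qed.

Lemma derive_coordinate_line :
  'D_1 (cmap d \o coordinate_line e p y) 0 = 'D_y h (cmap e p).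
Proof.
by rewrite -derive_line; apply: near_eq_derive; apply: filterS coordinate_line_transition.
Qed.

End Line.

Lemma coordinate_line_differentiable e p y : A e -> cdom e p ->
  differentiable_curve_at A (coordinate_line e p y) 0.
Proof.
move=> Ae ep; rewrite /differentiable_curve_at coordinate_line0//.
split; first by exists e.
move=> d Ad dp; split.
  by apply: filterS (near_coordinate_line y Ae Ad ep dp) => s [].
have [h [Ch hE]] := transition_map Ae Ad.
exact: (derivable_coordinate_line Ae Ad ep dp Ch hE).
Qed.

Lemma velocity_coord (c : R -> M) t d i :
  A d -> cdom d (c t) -> derivable (cmap d \o c) t 1 ->
  velocity A c t (fun q => cmap d q 0 i) = 'D_1 (cmap d \o c) t 0 i.
Proof.
move=> Ad dp dd; rewrite /velocity /on_germs asboolT; last exact: smooth_at_coord.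
by rewrite derive1E derive_mx// mxE.
Qed.

Lemma tangent_coordinate_line e p y : A e -> cdom e p ->
  tangent A p (velocity A (coordinate_line e p y) 0).
Proof.
move=> Ae ep; rewrite -{1}(coordinate_line0 y Ae ep).
apply: tangent_velocity; first exact: compatible_charts_manifold.
exact: coordinate_line_differentiable.
Qed.

(** The chain rule: the components of the velocity in another chart [d] are
    given by the derivative of the change of coordinates. *)
Lemma velocity_coordinate_line e d p y h i :
  A e -> A d -> cdom e p -> cdom d p ->
  Cinf (overlap e d) h ->
  (forall q, cdom e q -> cdom d q -> h (cmap e q) = cmap d q) ->
  velocity A (coordinate_line e p y) 0 (fun q => cmap d q 0 i) =
    'D_y h (cmap e p) 0 i.
Proof.
move=> Ae Ad ep dp Ch hE; rewrite velocity_coord ?coordinate_line0//.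
  by rewrite (derive_coordinate_line y Ae Ad ep dp hE).
exact: (derivable_coordinate_line Ae Ad ep dp Ch hE).
Qed.

End ManifoldCharts.

(** * The slit tangent bundle of a Finsler manifold *)

Section SlitBundle.
Context {R : realType} {n : nat} {M : topologicalType}.
Variable A : set (chart R M n).

Definition slit_chart (e : chart R M n) : chart R (@bundle R M) (n + n) :=
  Chart (TM0 A `&` [set u | cdom e u.1]) (induced_coordinates e).

Lemma slit_chart_atlas e : A e -> TM0_atlas A (slit_chart e).
Proof. by exists e. Qed.

Lemma finsler_g_flat (L : @bundle R M -> R) u v (k : R) :
  (\forall t \near (0 : R), L (u.1, u.2 + t *: v) ^+ 2 = k) ->
  finsler_g L u v v = 0.
Proof.
move=> Lk; rewrite /finsler_g /fibre_derivative derive1E.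
rewrite (near_eq_derive (g := cst 0)) ?derive_cst ?mulr0//.
apply: filterS (nbhs_interior Lk) => t tk.
rewrite derive1E (near_eq_derive (g := cst k)) ?derive_cst//.
have : \forall s \near (0 : R), L (u.1, u.2 + (s + t) *: v) ^+ 2 = k.
  have : \forall s \near t, L (u.1, u.2 + s *: v) ^+ 2 = k by exact: tk.
  by rewrite (near_shift 0 t) subr0.
by apply: filterS => s <-; rewrite /= -addrA -scalerDl [t + s]addrC.
Qed.

(** At most one multiple of [v] cancels [w], and it is not the zero one. *)
Lemma near_add_scale_neq0 (V : lmodType R) (w v : V) : w <> 0 ->
  \forall t \near (0 : R), w + t *: v <> 0.
Proof.
move=> w0; have [[t0 wt0]|nw] := pselect (exists t, w + t *: v = 0); last first.
  by near=> t => wt; apply: nw; exists t.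
have t00 : t0 != 0.
  by apply/eqP => t00; apply: w0; rewrite -wt0 t00 scale0r addr0.
have : \forall t \near (0 : R), `|t| < `|t0| by apply: nbhs0_lt; rewrite normr_gt0.
apply: filterS => t tt0 wt.
have [v0|/eqP v0] := pselect (v = 0).
  by apply: w0; rewrite -wt0 v0 scaler0 addr0.
have : (t - t0) *: v = 0.
  by rewrite scalerBl -(addKr w (t *: v)) -(addKr w (t0 *: v)) wt wt0 subrr.
move/eqP; rewrite scaler_eq0 (negbTE v0) orbF subr_eq0 => /eqP tE.
by rewrite tE ltxx in tt0.
Unshelve. all: by end_near. Qed.

(** [L] sees [v] only through its components, which vanish, so near [u]
    it is constant along the line through [u] in the direction [v], contradicting
    positive definiteness unless [v = 0]. The segment has to avoid the zero
    vector, where smoothness of [L] says nothing. *)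
Lemma finsler_coord_inj (L : @bundle R M -> R) (u : bundle) e v :
  finsler A L -> TM0 A u -> A e -> cdom e u.1 -> tangent A u.1 v ->
  (forall i, v (fun q => cmap e q 0 i) = 0) -> v = 0.
Proof.
move=> hL Tu Ae eu tv vi; have [Tu1 u0] := Tu.
apply: contrapT => v0.
suff vv0 : finsler_g L u v v = 0.
  by have := finsler_posdef hL Tu tv v0; rewrite vv0 ltxx.
have [W [h [oW Wu _ Lh]]] := finsler_smooth hL
  (slit_chart_atlas Ae) (conj Tu eu) (slit_chart_atlas Ae) (conj Tu eu).
apply: (finsler_g_flat (k := h (induced_coordinates e u) ^+ 2)).
apply: filterS (near_add_scale_neq0 v u0) => t t0.
have ind : induced_coordinates e (u.1, u.2 + t *: v) = induced_coordinates e u.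
  congr row_mx; apply/rowP => i; rewrite !mxE /=.
  have vE : (u.2 + t *: v) (fun q => cmap e q 0 i) =
    u.2 (fun q => cmap e q 0 i) + t * v (fun q => cmap e q 0 i) by [].
  by rewrite vE vi mulr0 addr0.
rewrite Lh /= ?ind//; split=> //; split=> //=.
by rewrite addrC; exact: tangent_lin.
Qed.

Hypothesis hM : smooth_manifold A.
Variable L : @bundle R M -> R.
Hypothesis hL : finsler A L.

(** Both sides have the same components in the chart [e]. The fundamental
    tensor makes this sufficient. *)
Lemma coordinate_line_of_tangent (u : bundle) e : TM0 A u -> A e -> cdom e u.1 ->
  u.2 = velocity A
    (coordinate_line e u.1 (rsubmx (induced_coordinates e u))) 0.
Proof.
move=> Tu Ae eu; rewrite row_mxKr; set y := \row_i _.
apply/subr0_eq; apply: (finsler_coord_inj hL Tu Ae eu).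
  by apply: tangentB; [exact: Tu.1|exact: tangent_coordinate_line].
move=> i.
have vE (v w : (M -> R) -> R) f : (v - w) f = v f - w f by [].
have Cid : Cinf (overlap e e) (@id 'rV[R]_n) .
  have [h [Ch hE]] := transition_map hM Ae Ae.
  move=> k; apply: eq_Ck (Ch k); first exact: (open_overlap hM).
  by move=> _ [q [eq _] <-]; rewrite hE.
rewrite vE (velocity_coordinate_line hM _ _ Ae Ae eu eu Cid)//.
by rewrite derive_id /y mxE subrr.
Qed.

Lemma induced_transition (u : bundle) e d h :
  A e -> A d -> TM0 A u -> cdom e u.1 -> cdom d u.1 ->
  Cinf (overlap e d) h ->
  (forall q, cdom e q -> cdom d q -> h (cmap e q) = cmap d q) ->
  let z := induced_coordinates e u in
  induced_coordinates d u = row_mx (h (lsubmx z)) ('D_(rsubmx z) h (lsubmx z)).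
Proof.
move=> Ae Ad Tu eu du Ch hE z.
have zl : lsubmx z = cmap e u.1 by rewrite row_mxKl.
rewrite zl hE//; congr row_mx; apply/rowP => i.
by rewrite mxE {1}(coordinate_line_of_tangent Tu Ae eu)
  (velocity_coordinate_line hM _ _ Ae Ad eu du Ch hE).
Qed.

(** Joint continuity of [(x, y) |-> 'D_y h x], from that of the partial
    derivatives of [h] by expanding [y] in the standard basis. *)
Lemma continuous_tangent_map (h : 'rV[R]_n -> 'rV[R]_n) (U : set 'rV[R]_n) z :
  open U -> Cinf U h -> U (lsubmx z) ->
  {for z, continuous (fun z : 'rV[R]_(n + n) =>
     row_mx (h (lsubmx z)) ('D_(rsubmx z) h (lsubmx z)))}.
Proof.
move=> oU Ch Uz.
have cl : {for z, continuous (lsubmx : 'rV[R]_(n + n) -> 'rV[R]_n)}.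
  exact: continuous_lsubmx.
have coordl (f : 'rV[R]_n -> 'rV[R]_n) j :
    {for lsubmx z, continuous f} ->
    {for z, continuous (fun w : 'rV[R]_(n + n) => f (lsubmx w) 0 j)}.
  move=> cf.
  apply: (@continuous_comp _ _ _ (f \o lsubmx) (fun N : 'rV[R]_n => N 0 j)).
    exact: continuous_comp.
  exact: coord_continuous.
apply: continuous_mx => i j; rewrite ord1; case: (split_ordP j) => k ->.
  rewrite (_ : (fun _ => _) = (fun w => h (lsubmx w) 0 k)); last first.
    by apply/funext => w; rewrite row_mxEl.
  by apply: coordl; exact: (Ck_continuous (Ch 0%N) Uz).
have expand w : U (lsubmx w) ->
    \sum_j (rsubmx w : 'rV_n) 0 j * 'D_(delta_mx 0 j) h (lsubmx w) 0 k =
    row_mx (h (lsubmx w)) ('D_(rsubmx w) h (lsubmx w)) 0 (rshift n k).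
  move=> Uw; rewrite row_mxEr.
  have dh : differentiable h (lsubmx w) by have [+ _] := Ch 1%N; exact.
  rewrite [in RHS]deriveE// [X in 'd h (lsubmx w) X]row_sum_delta linear_sum summxE.
  by apply: eq_bigr => l _; rewrite linearZ/= deriveE// [RHS]mxE.
have csum : {for z, continuous (fun w : 'rV[R]_(n + n) =>
    \sum_j (rsubmx w : 'rV_n) 0 j * 'D_(delta_mx 0 j) h (lsubmx w) 0 k)}.
  apply: (@cvg_big _ _ _ _ _ (@add_continuous R^o) _ (nbhs z)) => l _; apply: cvgM.
    apply: (@continuous_comp _ _ _ rsubmx (fun N : 'rV[R]_n => N 0 l)).
      exact: continuous_rsubmx.
    exact: coord_continuous.
  apply: (coordl ('D_(delta_mx 0 l) h) k).
  by have [_ /(_ (delta_mx 0 l)) Dh] := Ch 1%N; exact: Dh.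
rewrite /prop_for /continuous_at -(expand z Uz).
apply: (cvg_trans (@near_eq_cvg _ _ (nbhs z) _ _ _ _) csum).
have nU : \forall w \near z, U (lsubmx w) by apply: cl; exact: open_nbhs_nbhs.
by apply: filterS nU => w; exact: expand.
Qed.

Lemma compatible_charts_slit u : compatible_charts_at (TM0_atlas A) u.
Proof.
move=> _ _ [d Ad <-] [e Ae <-] /= [Tu du] [_ eu] W oW Wu.
have [h [Ch hE]] := transition_map hM Ae Ad.
pose z := induced_coordinates e u.
have zl : lsubmx z = cmap e u.1 by rewrite row_mxKl.
have oU := open_overlap hM Ae Ad.
have Uz : overlap e d (lsubmx z) by rewrite zl; exists u.1.
have cz := continuous_tangent_map oU Ch Uz.
pose N := [set w : 'rV[R]_(n + n) | overlap e d (lsubmx w) /\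
  W (row_mx (h (lsubmx w)) ('D_(rsubmx w) h (lsubmx w)))].
have Nz : nbhs z N.
  apply: filterI.
    by apply: continuous_lsubmx; exact: open_nbhs_nbhs.
  apply: cz; rewrite -(induced_transition Ae Ad Tu eu du Ch hE).
  exact: open_nbhs_nbhs.
exists N°; split; [exact: open_interior|exact: Nz|].
move=> w [Tw ew] /interior_subset[Uw Ww].
have dw : cdom d w.1.
  by apply: (mem_overlap hM Ae ew); move: Uw; rewrite row_mxKl.
by split=> //; rewrite (induced_transition Ae Ad Tw ew dw Ch hE).
Qed.

Lemma smooth_at_comp_fst (u : bundle) f : smooth_at A u.1 f ->
  smooth_at (TM0_atlas A) u (f \o fst).
Proof.
move=> sf _ [e Ae <-] [Tu eu].
have [W [h [oW Wu Ch fh]]] := sf e Ae eu.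
exists (lsubmx @^-1` W), (h \o lsubmx); split.
- by apply: open_comp => // x _; exact: continuous_lsubmx.
- by rewrite /= row_mxKl.
- move=> k; apply: (@Ck_comp_linear _ _ _ _ _ _ lsubmx) => //.
  exact: continuous_lsubmx.
- by move=> q [_ eq]; rewrite /= row_mxKl => Wq; exact: fh.
Qed.

Section Lift.
Variables (I : set R) (c : R -> M).
Hypotheses (oI : open I) (rc : regular_curve A I c).

Lemma TM0_canonical_lift t : I t -> TM0 A (canonical_lift A c t).
Proof.
move=> It; split; last exact: rc.2.
apply: tangent_velocity; first exact: compatible_charts_manifold.
exact: (smooth_curve_differentiable hM rc.1).
Qed.

(** In the induced coordinates the lift is [(x(s), x'(s))], where [x] is [c]
    read in the chart. *)
Lemma lift_differentiable t : I t ->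
  differentiable_curve_at (TM0_atlas A) (canonical_lift A c) t.
Proof.
move=> It; have dct := smooth_curve_differentiable hM rc.1.
have [[e Ae et] _] := dct t It.
split.
  exists (slit_chart e); first exact: slit_chart_atlas.
  by split => //; exact: TM0_canonical_lift.
move=> _ [{}e {}Ae <-] [_ {}et].
have nIt : \forall s \near t, I s by exact: open_nbhs_nbhs.
have net : \forall s \near t, cdom e (c s) by exact: ((dct t It).2 e Ae et).1.
split; first by near=> s; split; [apply: TM0_canonical_lift; near: s|near: s].
have [J [oJ Jt] CJ] := (rc.1 t It).2 e Ae et.
apply: (@near_eq_derivable _ _ _
    (fun s => row_mx ((cmap e \o c) s) ('D_1 (cmap e \o c) s))).
  near=> s; rewrite /= /induced_coordinates /canonical_lift/=.
  congr row_mx; apply/rowP => i; rewrite mxE velocity_coord//.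
    by near: s.
  apply/derivable1_diffP; have [+ _] := CJ 1%N; apply.
  by near: s; exact: open_nbhs_nbhs.
have d0 : derivable (cmap e \o c) t 1.
  by apply/derivable1_diffP; have [+ _] := CJ 1%N; exact.
have d1 : derivable ('D_1 (cmap e \o c)) t 1.
  by apply/derivable1_diffP; have [_ /(_ 1)[+ _]] := CJ 2%N; exact.
apply/derivable_mxP => i j; rewrite ord1; case: (split_ordP j) => k ->.
  under eq_fun do rewrite row_mxEl.
  by move/derivable_mxP : d0; exact.
under eq_fun do rewrite row_mxEr.
by move/derivable_mxP : d1; exact.
Unshelve. all: by end_near. Qed.

Lemma tangent0_lift t : I t ->
  tangent0 A (canonical_lift A c t)
    (velocity (TM0_atlas A) (canonical_lift A c) t).
Proof.
move=> It; apply: tangent_velocity; first exact: compatible_charts_slit.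
exact: lift_differentiable.
Qed.

Lemma rho_velocity_lift t :
  rho_map A (canonical_lift A c t)
    (velocity (TM0_atlas A) (canonical_lift A c) t) = velocity A c t.
Proof.
apply/funext => f; rewrite /rho_map /velocity /on_germs /=.
case: asboolP => // sf.
by rewrite asboolT//; exact: smooth_at_comp_fst.
Qed.

End Lift.

End SlitBundle.

(** * Horizontal vectors of regular connections *)

Section RegularConnections.
Context {R : realType} {n : nat} {M : topologicalType}.
Variable A : set (chart R M n).

Lemma rho_mapB (u : @bundle R M) xi zeta :
  rho_map A u (xi - zeta) = rho_map A u xi - rho_map A u zeta.
Proof.
apply/funext => f.
have E : (rho_map A u xi - rho_map A u zeta) f =
  rho_map A u xi f - rho_map A u zeta f by [].
by rewrite E /rho_map /on_germs; case: asboolP => // _; rewrite subr0.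
Qed.

Lemma rho_map0 (u : @bundle R M) : rho_map A u 0 = 0.
Proof. by rewrite -(subrr (0 : (@bundle R M -> R) -> R)) rho_mapB subrr. Qed.

Section OneConnection.
Variable nabla : connection_operator (R := R) (M := M).
Hypothesis reg : regular A nabla.

(** Existence of the horizontal vector: it is the horizontal part of [xi], since
    subtracting the vertical part does not change the image under [rho]. *)
Lemma beta_mapP (u : @bundle R M) xi : TM0 A u -> tangent0 A u xi ->
  [/\ tangent0 A u (beta_map A nabla u (rho_map A u xi)),
      deflection nabla u (beta_map A nabla u (rho_map A u xi)) = 0 &
      rho_map A u (beta_map A nabla u (rho_map A u xi)) = rho_map A u xi].
Proof.
move=> Tu txi; apply: (@xgetPex _ 0 [set z |
  [/\ tangent0 A u z, deflection nabla u z = 0 & rho_map A u z = rho_map A u xi]]).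
have [[z1 z2] [[[_ rz1] [tz2 dz2] xiE] _]] := reg.2 u xi Tu txi.
exists z2; split=> //=; rewrite -[RHS]subr0 -rz1 -rho_mapB xiE /=.
by rewrite [z1 + z2]addrC addrK.
Qed.

(** Uniqueness: [0 + xi] and [(xi - beta (rho xi)) + beta (rho xi)] are two
    decompositions of [xi] into a vertical and a horizontal part. *)
Lemma beta_map_horizontal (u : @bundle R M) xi : TM0 A u -> tangent0 A u xi ->
  deflection nabla u xi = 0 -> beta_map A nabla u (rho_map A u xi) = xi.
Proof.
move=> Tu txi dxi; have [tb db rb] := beta_mapP Tu txi.
have [z [_ uz]] := reg.2 u xi Tu txi.
have z1 : z = (0, xi).
  apply: uz; split=> //=; last by rewrite add0r.
  by rewrite rho_map0; split => //; exact: tangent_zero.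
have z2 : z = (xi - beta_map A nabla u (rho_map A u xi),
               beta_map A nabla u (rho_map A u xi)).
  apply: uz; split=> //=; last by rewrite subrK.
  by rewrite rho_mapB rb subrr; split => //; exact: tangentB.
by move: z2; rewrite z1 => -[].
Qed.

End OneConnection.

(** The pointwise form of the theorem, for an arbitrary tangent vector [xi] in
    place of the velocity of the lift and [rho xi] in place of [etabar]. *)
Lemma omega_beta_eq0 (nabla nablat : connection_operator) (u : @bundle R M) xi :
  regular A nabla -> regular A nablat ->
  TM0 A u -> tangent0 A u xi ->
  (deflection nabla u xi = 0 ->
   (deflection nablat u xi = 0 <->
    omega nabla nablat u (beta_map A nabla u (rho_map A u xi)) etabar = 0)) /\
  (deflection nablat u xi = 0 ->
   (deflection nabla u xi = 0 <->
    omega nabla nablat u (beta_map A nabla u (rho_map A u xi)) etabar = 0)).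
Proof.
move=> reg regt Tu txi.
have omE z : deflection nabla u z = 0 ->
    omega nabla nablat u z etabar = deflection nablat u z.
  by rewrite /deflection /omega => ->; rewrite subr0.
split=> dxi; first by rewrite (beta_map_horizontal reg)// omE.
split=> [dxi'|]; first by rewrite (beta_map_horizontal reg)// omE.
(* [beta (rho xi)] is horizontal for both connections, so it is also the
   horizontal vector of the second one over [rho xi], which is [xi] *)
have [tb db rb] := beta_mapP reg Tu txi.
rewrite omE// => dtb.
have := beta_map_horizontal regt Tu txi dxi.
by rewrite -rb (beta_map_horizontal regt Tu tb dtb) => <-.
Qed.

End RegularConnections.

Theorem theorem6p2 (R : realType) (n : nat) (M : topologicalType)
    (A : set (chart R M n)) (L Lt : bundle -> R) (sigma : M -> R)
    (nabla nablat : connection_operator)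
    (hM : smooth_manifold A)
    (hL : finsler A L) (hLt : finsler A Lt)
    (hsigma : smooth_function A sigma)
    (hconf : forall u v w, TM0 A u -> tangent A u.1 v -> tangent A u.1 w ->
      finsler_g Lt u v w = expR (2 * sigma u.1) * finsler_g L u v w)
    (hnabla : cartan_connection A L nabla)
    (hnablat : cartan_connection A Lt nablat)
    (I : set R) (hIopen : open I) (hI : is_interval I) (c : R -> M) :
  (geodesic A nabla I c ->
    (geodesic A nablat I c <->
     forall t, I t ->
       B_tensor A nabla nablat etabar etabar (canonical_lift A c t) = 0)) /\
  (geodesic A nablat I c ->
    (geodesic A nabla I c <->
     forall t, I t ->
       B_tensor A nabla nablat etabar etabar (canonical_lift A c t) = 0)).
Proof.
have [reg _ _ _] := hnabla; have [regt _ _ _] := hnablat.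
have key t : regular_curve A I c -> I t ->
    let u := canonical_lift A c t in
    let xi := velocity (TM0_atlas A) (canonical_lift A c) t in
    (deflection nabla u xi = 0 -> (deflection nablat u xi = 0 <->
      B_tensor A nabla nablat etabar etabar u = 0)) /\
    (deflection nablat u xi = 0 -> (deflection nabla u xi = 0 <->
      B_tensor A nabla nablat etabar etabar u = 0)).
  move=> rc It u xi; rewrite /B_tensor.
  rewrite (_ : etabar u = rho_map A u xi); last by rewrite rho_velocity_lift.
  apply: omega_beta_eq0 => //; first exact: (TM0_canonical_lift hM rc It).
  exact: (tangent0_lift hM hL hIopen rc It).
split=> -[rc gc]; split=> [[_ gct] t It|B0].
- by have [+ _] := key t rc It; move=> /(_ (gc t It)) <-; exact: gct.
- by split=> // t It; have [+ _] := key t rc It; move=> /(_ (gc t It)) ->; exact: B0.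
- by have [_ +] := key t rc It; move=> /(_ (gc t It)) <-; exact: gct.
- by split=> // t It; have [_ +] := key t rc It; move=> /(_ (gc t It)) ->; exact: B0.
Qed.
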